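(* Let $G$ be a path-bipartite graph of the sets $A$ and $B$. If $\min\{|A|,|B|\}\le 1$ (i.e. at least one of the sets $A$, $B$ has exactly one point), then the following statements are equivalent: (i) $G$ is connected. (ii) $G$ is path-complete, i.e. $\mathcal{B}_{path}(G)=A\times B$.
   Context: Graphs are simple (no loops, no multiple edges), have a nonempty vertex set $V(G)$ and edge set $E(G)$, and may be infinite. A path is a finite graph $P$ whose (distinct) vertices can be numbered $u_0,\dots,u_k$, $k\ge 1$, so that $E(P)=\{\{u_0,u_1\},\dots,\{u_{k-1},u_k\}\}$; it joins $u_0$ and $u_k$. A graph is connected if any two distinct vertices are joined by a path in it. Let $A,B$ be nonempty disjoint sets. A path $P$ is a be-path of $A$ and $B$ if $V(P)\subseteq A\cup B$ and there is exactly one edge $\{a_0,b_0\}\in E(P)$ meeting both $A$ and $B$. A graph $G$ is a path-bipartite graph of $A$ and $B$ if $A,B\subseteq V(G)$ and $G$ is the union (of vertex sets and of edge sets) of a nonempty set of be-paths of $A$ and $B$. For such $G$, $\mathcal{B}_{path}(G)$ is the set of all $(a,b)\in A\times B$ for which there is a be-path of $A$ and $B$ that is a subgraph of $G$ and joins $a$ and $b$. *)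

(* Defs.v *)
From mathcomp Require Import all_boot.
From mathcomp Require Import boolp classical_sets functions cardinality.

Set Implicit Arguments.
Unset Strict Implicit.
Unset Printing Implicit Defensive.

Local Open Scope classical_set_scope.

(* Possibly infinite simple graphs, with vertices drawn from an ambient type T;
   an edge is an unordered pair, i.e. a two-element set of vertices. *)
Record graph (T : Type) := Graph {
  vset : set T;
  eset : set (set T);
  vset_nonempty : vset !=set0;
  eset_simple : forall e, eset e ->
    exists x y, [/\ vset x, vset y, x <> y & e = [set x; y]]
}.

Definition subgraph (T : Type) (H G : graph T) : Prop :=
  vset H `<=` vset G /\ eset H `<=` eset G.

(* Only the values u 0, ..., u k matter. *)
Definition path_numbering (T : Type) (P : graph T) (k : nat) (u : nat -> T) :
    Prop :=
  [/\ 1 <= k,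
      forall i j, i <= k -> j <= k -> u i = u j -> i = j,
      vset P = [set u i | i in [set i | i <= k]] &
      eset P = [set [set u i; u i.+1] | i in [set i | i < k]]].

Definition is_path (T : Type) (P : graph T) : Prop :=
  exists k u, path_numbering P k u.

Definition path_joins (T : Type) (P : graph T) (x y : T) : Prop :=
  exists k u, [/\ path_numbering P k u, u 0 = x & u k = y].

Definition connected_graph (T : Type) (G : graph T) : Prop :=
  forall x y, vset G x -> vset G y -> x <> y ->
    exists P, subgraph P G /\ path_joins P x y.

Definition be_path (T : Type) (A B : set T) (P : graph T) : Prop :=
  [/\ is_path P,
      vset P `<=` A `|` B &
      exists! e, [/\ eset P e, e `&` A !=set0 & e `&` B !=set0]].

(* The standing assumption that A and B are nonempty and disjoint is not part
   of these definitions and has to be assumed separately. *)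
Definition path_bipartite (T : Type) (A B : set T) (G : graph T) : Prop :=
  [/\ A `<=` vset G, B `<=` vset G &
      exists F : set (graph T),
        [/\ F !=set0,
            forall P, F P -> be_path A B P,
            vset G = \bigcup_(P in F) vset P &
            eset G = \bigcup_(P in F) eset P]].

Definition Bpath (T : Type) (A B : set T) (G : graph T) : set (T * T) :=
  [set ab | [/\ A ab.1, B ab.2 &
    exists P, [/\ be_path A B P, subgraph P G & path_joins P ab.1 ab.2]]].

Definition path_complete (T : Type) (A B : set T) (G : graph T) : Prop :=
  Bpath A B G = A `*` B.

(* Main.v *)
Require Import Defs.
From mathcomp Require Import all_boot.
From mathcomp Require Import boolp classical_sets functions cardinality.
From mathcomp Require Import zify.

Set Implicit Arguments.
Unset Strict Implicit.
Unset Printing Implicit Defensive.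

Local Open Scope classical_set_scope.

(** If [A = {a}], every path in [G] that starts at [a] never returns to [A], so
    its first edge is its only crossing edge and it is a be-path. Conversely,
    path-completeness links every vertex of [A] with every vertex of [B], hence
    any two vertices by a walk, and a walk of minimal length is a path. *)

(** Vertices may repeat, and only [w 0], ..., [w n] matter. Length 0 is allowed at any point of [T],
    so [reachable] is reflexive. *)
Definition walk (T : Type) (G : graph T) (n : nat) (w : nat -> T) : Prop :=
  forall i, i < n -> eset G [set w i; w i.+1].

Definition reachable (T : Type) (G : graph T) (x y : T) : Prop :=
  exists n w, [/\ walk G n w, w 0 = x & w n = y].

Lemma reachable_sym (T : Type) (G : graph T) (x y : T) :
  reachable G x y -> reachable G y x.
Proof.
move=> [n [w [ww w0 wn]]]; exists n, (fun i => w (n - i)); split.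
- move=> i ltin; rewrite setUC.
  have -> : n - i = (n - i.+1).+1 by lia.
  by apply: ww; lia.
- by rewrite subn0.
- by rewrite subnn.
Qed.

Lemma reachable_trans (T : Type) (G : graph T) (x y z : T) :
  reachable G x y -> reachable G y z -> reachable G x z.
Proof.
move=> [n [w [ww w0 wn]]] [m [v [wv v0 vm]]].
exists (n + m), (fun i => if i <= n then w i else v (i - n)); split=> [i lti||].
- case: (ltngtP i n) => [ltin|ltni|ein].
  + exact: ww.
  + have -> : i.+1 - n = (i - n).+1 by lia.
    by apply: wv; lia.
  + by rewrite ein wn -v0 subSnn; apply: wv; lia.
- by [].
(* If the endpoint index [n + m] still falls in the first branch, then [m = 0] and [y = z]. *)
- case: leqP => [lenm|_]; last by rewrite addKn.
  have m0 : m = 0 by lia.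
  by rewrite m0 addn0 wn -v0 -vm m0.
Qed.

(** The closed stretch between the two equal vertices is cut out, which strictly shortens the walk;
    this is what contradicts minimality of length. *)
Lemma walk_shortcut (T : Type) (G : graph T) (n : nat) (w : nat -> T)
    (i j : nat) :
  walk G n w -> i < j <= n -> w i = w j ->
  exists v, [/\ walk G (n - (j - i)) v, v 0 = w 0 & v (n - (j - i)) = w n].
Proof.
move=> ww /andP[ltij lejn] wij.
exists (fun t => if t <= i then w t else w (t + (j - i))); split=> [t ltt||].
- case: (ltngtP t i) => [ltti|ltit|eti].
  + by apply: ww; lia.
  + by rewrite addSn; apply: ww; lia.
  + rewrite eti wij (_ : i.+1 + (j - i) = j.+1); last by lia.
    by apply: ww; lia.
- by [].
(* The first branch covers the endpoint only when [j = n]: the new walk then stops at [w i], which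
   equals [w n]. *)
- case: leqP => [len|_]; last by congr w; lia.
  have -> : n - (j - i) = i by lia.
  by rewrite wij; congr w; lia.
Qed.

Lemma reachable_inj_walk (T : Type) (G : graph T) (x y : T) :
  reachable G x y ->
  exists n w, [/\ walk G n w, w 0 = x, w n = y &
    forall i j, i <= n -> j <= n -> w i = w j -> i = j].
Proof.
move=> rxy.
pose Q n := `[< exists w, [/\ walk G n w, w 0 = x & w n = y] >].
have exQ : exists n, Q n by have [n ?] := rxy; exists n; apply/asboolP.
case: (ex_minnP exQ) => n /asboolP[w [ww w0 wn]] minn.
exists n, w; split=> //.
suff no_repeat i j : i < j <= n -> w i <> w j.
  move=> i j lein lejn wij; case: (ltngtP i j) => // lt.
  - by case: (@no_repeat i j) => //; rewrite lt.
  - by case: (@no_repeat j i) => //; rewrite lt.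
move=> ltijn wij; have [v [wv v0 vn]] := walk_shortcut ww ltijn wij.
have : n <= n - (j - i).
  by apply: minn; apply/asboolP; exists v; rewrite v0 vn.
by lia.
Qed.

Lemma reachable_path (T : Type) (G : graph T) (x y : T) :
  x <> y -> reachable G x y -> exists P, subgraph P G /\ path_joins P x y.
Proof.
move=> xy rxy; have [n [w [ww w0 wn winj]]] := reachable_inj_walk rxy.
have n_gt0 : 0 < n.
  by rewrite lt0n; apply/eqP => n0; apply: xy; rewrite -w0 -wn n0.
pose V := [set w i | i in [set i | i <= n]].
pose E := [set [set w i; w i.+1] | i in [set i | i < n]].
have V0 : V !=set0 by exists (w 0); exists 0.
have Esimple e : E e -> exists x y, [/\ V x, V y, x <> y & e = [set x; y]].
  move=> [i /= ltin <-]; exists (w i), (w i.+1); split=> //.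
  - by exists i => //=; lia.
  - by exists i.+1.
  - by move=> /winj wi; have := wi (ltnW ltin) ltin; lia.
have VG v : V v -> vset G v.
  move=> [i /= lein <-].
  (* A walk mentions only edges, so its vertices are found in [G] as ends of edges. As [n > 0], each
     has one: [w 0] starts the first edge, and any later vertex ends the edge before it. *)
  have endpoints j : j < n -> vset G (w j) /\ vset G (w j.+1).
    move=> /ww Ej; have [a [b [Ga Gb _ eab]]] := eset_simple Ej.
    have sub c : [set a; b] c -> vset G c by case=> ->.
    by split; apply: sub; rewrite -eab; [left|right].
  case: i lein => [|i] lein; first by have [] := endpoints 0 n_gt0.
  by have [] := endpoints i lein.
exists (Graph V0 Esimple); split.
  by split=> // e [i /= ltin <-]; exact: ww.
by exists n, w; split.
Qed.

Lemma path_reachable (T : Type) (P G : graph T) (x y : T) :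
  subgraph P G -> path_joins P x y -> reachable G x y.
Proof.
move=> [_ PG] [k [u [[_ _ _ EP] u0 uk]]]; exists k, u; split=> // i ltik.
by apply: PG; rewrite EP; exists i.
Qed.

Lemma path_joins_sym (T : Type) (P : graph T) (x y : T) :
  path_joins P x y -> path_joins P y x.
Proof.
move=> [k [u [[k_gt0 uinj VP EP] u0 uk]]].
exists k, (fun i => u (k - i)); split; rewrite ?subn0 ?subnn //; split=> //.
- by move=> i j leik lejk /uinj; lia.
- rewrite VP; apply/seteqP; split=> _ [i /= leik <-].
  + by exists (k - i); [exact: leq_subr|rewrite subKn].
  + by exists (k - i); [exact: leq_subr|].
(* Reversal carries edge number [i] to edge number [k - i.+1] with its two ends exchanged; the same
   index serves both inclusions. *)
- rewrite EP; apply/seteqP; split=> _ [i /= ltik <-]; exists (k - i.+1) => /=;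
    rewrite 1?setUC; try lia.
  + have -> : k - (k - i.+1).+1 = i by lia.
    by have -> : k - (k - i.+1) = i.+1 by lia.
  + by have -> : (k - i.+1).+1 = k - i by lia.
Qed.

Lemma be_path_swap (T : Type) (A B : set T) (P : graph T) :
  be_path A B P -> be_path B A P.
Proof.
move=> [pP PAB [e [[Pe eA eB] uniq_e]]]; split=> //; first by rewrite setUC.
by exists e; split=> // e' [Pe' e'B e'A]; apply: uniq_e.
Qed.

Lemma be_path_from_point (T : Type) (A B : set T) (P : graph T) (a b : T) :
  is_subset1 A -> A a -> vset P `<=` A `|` B -> path_joins P a b ->
  be_path A B P.
Proof.
move=> A1 Aa PAB [k [u [uP u0 uk]]]; have [k_gt0 uinj VP EP] := uP.
have A0 i : i <= k -> A (u i) -> i = 0.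
  by move=> leik Aui; apply: uinj => //; rewrite u0; exact: A1.
split=> //; first by exists k, u.
exists [set u 0; u 1]; split.
  split.
  - by rewrite EP; exists 0.
  - by exists (u 0); split; [left|rewrite u0].
  - exists (u 1); split; first by right.
    have : (A `|` B) (u 1) by apply: PAB; rewrite VP; exists 1.
    by move=> [Au1|//]; have := A0 1 k_gt0 Au1.
move=> e [+ [c [ec Ac]] _]; rewrite EP => -[i /= ltik eE]; subst e.
(* Meeting [A] already forces the edge to be the first: [A (u i)] gives [i = 0], while [A (u i.+1)]
   would give [i.+1 = 0]. *)
by case: ec => cE; rewrite cE in Ac;
  [rewrite (A0 i (ltnW ltik) Ac)|have := A0 _ ltik Ac].
Qed.

(** This places every path in [G] inside the union of [A] and [B], as a be-path requires. *)
Lemma path_bipartite_vset (T : Type) (A B : set T) (G : graph T) :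
  path_bipartite A B G -> vset G = A `|` B.
Proof.
move=> [AG BG [F [_ FP VG _]]]; apply/seteqP; split; last by rewrite subUset.
by rewrite VG => x [P /FP[_ PAB _]]; exact: PAB.
Qed.

(** An injection into [I_1] sends every point of [A] to 0. *)
Lemma card_le_I1_subset1 (T : Type) (A : set T) :
  (A #<= `I_1)%card -> is_subset1 A.
Proof.
move=> /pcard_leP[f] x y Ax Ay.
have f0 z : A z -> f z = 0 by move=> /(@funS _ _ _ _ f) /=; case: (f z).
have fxy : f x = f y by rewrite !f0.
by apply: (@inj _ _ _ f) fxy; exact: mem_set.
Qed.

Lemma path_complete_connected (T : Type) (A B : set T) (G : graph T) :
  A !=set0 -> B !=set0 -> vset G = A `|` B -> path_complete A B G ->
  connected_graph G.
Proof.
move=> [a0 Aa0] [b0 Bb0] VG complete.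
have rAB a b : A a -> B b -> reachable G a b.
  move=> Aa Bb; have : Bpath A B G (a, b) by rewrite complete.
  by move=> [_ _ [P [_ PG Pab]]]; exact: path_reachable PG Pab.
have rb0 x : vset G x -> reachable G x b0.
  rewrite VG => -[Ax|Bx]; first exact: rAB.
  (* Completeness links only opposite sides, so a point of [B] reaches [b0] by a detour through
     [a0]. *)
  apply: (@reachable_trans _ _ _ a0); last exact: rAB.
  by apply: reachable_sym; exact: rAB.
move=> x y Gx Gy xy; apply: reachable_path => //.
by apply: reachable_trans (rb0 x Gx) _; apply: reachable_sym; exact: rb0.
Qed.

Lemma connected_path_complete (T : Type) (A B : set T) (G : graph T) :
  is_subset1 A \/ is_subset1 B -> A `&` B = set0 -> vset G = A `|` B ->
  connected_graph G -> path_complete A B G.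
Proof.
move=> AB1 AB0 VG connG; apply/seteqP; split=> -[a b]; first by case.
move=> [/= Aa Bb]; split=> //=.
have ab : a <> b.
  by move=> eab; have : (A `&` B) a by [split=> //; rewrite eab]; rewrite AB0.
have [||P [PG Pab]] := connG a b _ _ ab.
- by rewrite VG; left.
- by rewrite VG; right.
have PAB : vset P `<=` A `|` B by rewrite -VG; case: PG.
exists P; split=> //; case: AB1 => [A1|B1].
  exact: be_path_from_point A1 Aa PAB Pab.
(* When [B] is the one-point side, the path is reversed to start at [b] and the roles of [A] and [B]
   are exchanged. *)
rewrite setUC in PAB; apply: be_path_swap.
exact: be_path_from_point B1 Bb PAB (path_joins_sym Pab).
Qed.

Unset Implicit Arguments.

Theorem corollary2p8 (T : Type) (A B : set T) (G : graph T)
  (hA : A !=set0) (hB : B !=set0) (hAB : A `&` B = set0)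
  (hG : path_bipartite A B G)
  (hmin : (A #<= `I_1)%card \/ (B #<= `I_1)%card) :
  connected_graph G <-> path_complete A B G.
Proof.
have VG := path_bipartite_vset hG.
split; last exact: path_complete_connected.
apply: connected_path_complete => //.
by case: hmin => /card_le_I1_subset1; [left|right].
Qed.
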